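(* Suppose that for every $e\in E$ the restriction $p_e|_{K_{i(e)}}$ is Dini-continuous and that there exists $\delta>0$ with $p_e|_{K_{i(e)}}\ge\delta$ for all $e\in E$. Let $x_i,y_i\in K_i$ for all $1\le i\le N$ and let $\nu$ be a Borel probability measure on $K$. Then: (i) the limit $F_{x_1\dots x_N}(\sigma)=\lim_{m\to-\infty}Y^{x_1\dots x_N}_{m0}(\sigma)$ exists for all $\sigma$ outside a set of $\Phi(\nu)$-outer measure zero; (ii) $F_{x_1\dots x_N}=F_{y_1\dots y_N}$ outside a set of $\Phi(\nu)$-outer measure zero; (iii) there exist closed subsets $Q_1\subset Q_2\subset\cdots\subset\Sigma$ with $\lim_{k\to\infty}\Phi(\nu)(\Sigma\setminus Q_k)=0$ and constants $\alpha,C>0$ such that for every $k$ there is $\delta_k>0$ with: $F_{x_1\dots x_N}$ is defined on $Q_k$ and $d(F_{x_1\dots x_N}(\sigma),F_{x_1\dots x_N}(\sigma'))\le C\,d'(\sigma,\sigma')^\alpha$ for all $\sigma,\sigma'\in Q_k$ with $d'(\sigma,\sigma')\le\delta_k$.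
   Context: A contractive Markov system (CMS) with average contracting rate $0<a<1$ consists of: a finite directed multigraph $(V,E,i,t)$ with vertex set $V=\{1,\dots,N\}$, finite edge set $E$, and maps $i,t:E\to V$ giving the initial and terminal vertex of each edge; a complete metric space $(K,d)$ partitioned into non-empty Borel sets $K_1,\dots,K_N$; Borel measurable maps $w_e:K\to K$ ($e\in E$) with $w_e(K_{i(e)})\subset K_{t(e)}$; Borel measurable functions $p_e:K\to[0,\infty)$ with $\sum_{e\in E}p_e(x)=1$ for all $x\in K$ and $p_e=0$ on $K\setminus K_{i(e)}$; and such that $\sum_{e\in E}p_e(x)d(w_ex,w_ey)\leq a\,d(x,y)$ for all $x,y\in K_j$, $j=1,\dots,N$. A function $f:(X,d)\to\mathbb{R}$ is Dini-continuous if $\int_0^c\frac{\phi(t)}{t}dt<\infty$ for some $c>0$, where $\phi(t):=\sup\{|f(x)-f(y)|:d(x,y)\le t,\ x,y\in X\}$. Let $\Sigma:=E^{\mathbb{Z}}$ with metric $d'(\sigma,\sigma'):=(1/2)^k$ where $k$ is the largest integer with $\sigma_j=\sigma'_j$ for all $|j|<k$. For $m\le n$ the cylinder $_m[e_m,\dots,e_n]:=\{\sigma\in\Sigma:\sigma_j=e_j,\ m\le j\le n\}$. For an integer $m\le 1$, $\mathcal{A}_m$ is the $\sigma$-algebra generated by the cylinders $_m[e_m,\dots,e_n]$, $n\ge m$. For $x\in K$, $P^m_x$ is the probability measure on $(\Sigma,\mathcal{A}_m)$ with $P^m_x(_m[e_m,\dots,e_n])=p_{e_m}(x)\,p_{e_{m+1}}(w_{e_m}x)\cdots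 p_{e_n}(w_{e_{n-1}}\circ\cdots\circ w_{e_m}x)$. For a Borel probability measure $\nu$ on $K$, $\Phi_m(\nu)(A)=\int P^m_x(A)\,d\nu(x)$ for $A\in\mathcal{A}_m$. For $B\subset\Sigma$ let $\mathcal{C}(B)$ be the set of sequences $(A_m)_{m\le 0}$ with $A_m\in\mathcal{A}_m$ and $B\subset\bigcup_{m\le 0}A_m$, and $\Phi(\nu)(B):=\inf\{\sum_{m\le 0}\Phi_m(\nu)(A_m):(A_m)_{m\le0}\in\mathcal{C}(B)\}$ (an outer measure on $\Sigma$). For fixed $x_i\in K_i$, $Y^{x_1\dots x_N}_{m0}(\sigma):=w_{\sigma_0}\circ\cdots\circ w_{\sigma_m}(x_{i(\sigma_m)})$ for $m\le 0$, and $F_{x_1\dots x_N}(\sigma):=\lim_{m\to-\infty}Y^{x_1\dots x_N}_{m0}(\sigma)$ wherever this limit exists (the coding map). *)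

(* Defs.v *)
From HB Require Import structures.
From mathcomp Require Import all_boot all_order all_algebra.
From mathcomp Require Import all_classical all_reals all_analysis.
Set Implicit Arguments. Unset Strict Implicit. Unset Printing Implicit Defensive.
Import Order.TTheory GRing.Theory Num.Theory.
Local Open Scope classical_set_scope.
Local Open Scope ring_scope.

Section CMSDefs.
Variable R : realType.

Definition is_metric (K : Type) (d : K -> K -> R) : Prop :=
  [/\ (forall x y, 0 <= d x y), (forall x y, d x y = 0 <-> x = y),
      (forall x y, d x y = d y x) & (forall x y z, d x z <= d x y + d y z)].

Definition dcauchy (K : Type) (d : K -> K -> R) (u : nat -> K) : Prop :=
  forall eps : R, 0 < eps -> exists M : nat, forall n k : nat,
    (M <= n)%N -> (M <= k)%N -> d (u n) (u k) < eps.

Definition dcvg (K : Type) (d : K -> K -> R) (u : nat -> K) (y : K) : Prop :=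
  forall eps : R, 0 < eps -> exists M : nat, forall n : nat,
    (M <= n)%N -> d (u n) y < eps.

Definition is_complete_metric (K : Type) (d : K -> K -> R) : Prop :=
  is_metric d /\ forall u, dcauchy d u -> exists y, dcvg d u y.

Definition dopen (K : Type) (d : K -> K -> R) : set (set K) :=
  [set U | forall x, U x -> exists2 r : R, 0 < r & forall y, d x y < r -> U y].

Definition dclosed (K : Type) (d : K -> K -> R) (Q : set K) : Prop :=
  dopen d (~` Q).

Definition Borel (K : pointedType) (d : K -> K -> R) := g_sigma_algebraType (dopen d).

Definition modcont (K : Type) (d : K -> K -> R) (A : set K) (f : K -> R) (t : R)
  : \bar R :=
  ereal_sup [set z | exists x y, [/\ A x, A y, d x y <= t & z = (`|f x - f y|)%:E]].

Definition dini_on (K : Type) (d : K -> K -> R) (A : set K) (f : K -> R) : Prop :=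
  exists2 c : R, 0 < c &
    (\int[@lebesgue_measure R]_(t in [set t : R | (0 < t <= c)%R]) (modcont d A f t * (t^-1)%:E) < +oo)%E.

Definition CMS (K : pointedType) (d : K -> K -> R) (V E : finType) (ini ter : E -> V)
  (Kp : V -> set K) (w : E -> K -> K) (p : E -> K -> R) (a : R) : Prop :=
  [/\ is_complete_metric d,
      [/\ forall v, Kp v !=set0,
          forall v v', v <> v' -> Kp v `&` Kp v' = set0,
          (forall x, exists v, Kp v x) &
          forall v, measurable (Kp v : set (Borel d))],
      (forall e, measurable_fun [set: Borel d] (w e : Borel d -> Borel d)) /\
      (forall e x, Kp (ini e) x -> Kp (ter e) (w e x)),
      [/\ forall e, measurable_fun [set: Borel d] (p e : Borel d -> R),
          (forall e x, 0 <= p e x),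
          (forall x, \sum_(e : E) p e x = 1) &
          (forall e x, ~ Kp (ini e) x -> p e x = 0)] &
      [/\ 0 < a, a < 1 &
          forall j x y, Kp j x -> Kp j y ->
            \sum_(e : E) p e x * d (w e x) (w e y) <= a * d x y]].

Definition Sig (E : Type) := int -> E.

(* d'(s,s') = (1/2)^k, k the largest integer with s_j = s'_j for all |j| < k,
   i.e. k = the least n with s_n <> s'_n or s_{-n} <> s'_{-n}; d'(s,s) = 0 *)
Definition dSig (E : eqType) (s s' : Sig E) : R :=
  match pselect (exists n : nat,
      (s (n%:Z) != s' (n%:Z)) || (s (- n%:Z) != s' (- n%:Z))) with
  | left H => (2^-1) ^+ (ex_minn H)
  | right _ => 0
  end.

Definition cyl (E : Type) (m : int) (es : seq E) : set (Sig E) :=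
  [set s | forall k : nat, (k < size es)%N -> forall e0, s (m + k%:Z) = nth e0 es k].

(* generators of A_m: cylinders starting at m (n >= m, so es non-empty) *)
Definition cylsets (E : Type) (m : int) : set (set (Sig E)) :=
  [set cyl m es | es in [set es : seq E | es <> [::]]].

Definition Asig (E : Type) (m : int) : set (set (Sig E)) := <<s @cylsets E m >>.

Fixpoint cylP (K E : Type) (w : E -> K -> K) (p : E -> K -> R) (x : K) (es : seq E)
  : R :=
  match es with
  | [::] => 1
  | e :: es' => p e x * cylP w p (w e x) es'
  end.

(* a cylinder or the empty set (the semiring on which P^m_x is a premeasure) *)
Definition ocyl (E : Type) (m : int) (c : option (seq E)) : set (Sig E) :=
  if c is Some es then cyl m es else set0.
Definition ocylP (K E : Type) (w : E -> K -> K) (p : E -> K -> R) (x : K)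
  (c : option (seq E)) : R :=
  if c is Some es then cylP w p x es else 0.

(* P^m_x : the (Caratheodory) outer measure generated by the cylinder
   probabilities; restricted to A_m it is the measure P^m_x of the paper *)
Definition Pm (K E : Type) (w : E -> K -> K) (p : E -> K -> R) (m : int) (x : K)
  (A : set (Sig E)) : \bar R :=
  ereal_inf [set (\sum_(0 <= j <oo) (ocylP w p x (c j))%:E)%E |
             c in [set c : nat -> option (seq E) | A `<=` \bigcup_j ocyl m (c j)]].

Definition Phim (K : pointedType) (d : K -> K -> R) (E : Type)
  (w : E -> K -> K) (p : E -> K -> R) (nu : probability (Borel d) R) (m : int)
  (A : set (Sig E)) : \bar R :=
  (\int[nu]_x Pm w p m x A)%E.

Definition Phi (K : pointedType) (d : K -> K -> R) (E : Type)
  (w : E -> K -> K) (p : E -> K -> R) (nu : probability (Borel d) R)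
  (B : set (Sig E)) : \bar R :=
  ereal_inf [set (\sum_(0 <= n <oo) Phim w p nu (- n%:Z) (A n))%E |
             A in [set A : nat -> set (Sig E) |
                   (forall n, @Asig E (- n%:Z) (A n)) /\ B `<=` \bigcup_n A n]].

(* Y^{x_1..x_N}_{m0}(s) for m = -n:  w_{s_0} o ... o w_{s_{-n}} (x_{i(s_{-n})}) *)
Fixpoint Yaux (K E : Type) (w : E -> K -> K) (s : Sig E) (n : nat) (z : K) : K :=
  match n with
  | 0 => w (s 0) z
  | n'.+1 => Yaux w s n' (w (s (- n%:Z)) z)
  end.

Definition Y (K V E : Type) (ini : E -> V) (w : E -> K -> K) (xs : V -> K)
  (n : nat) (s : Sig E) : K :=
  Yaux w s n (xs (ini (s (- n%:Z)))).

Definition Fcode (K V E : Type) (d : K -> K -> R) (ini : E -> V) (w : E -> K -> K)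
  (xs : V -> K) (s : Sig E) (y : K) : Prop :=
  dcvg d (fun n => Y ini w xs n s) y.

End CMSDefs.

(* Main.v *)
Require Import Defs.
From HB Require Import structures.
From mathcomp Require Import all_boot all_order all_algebra.
From mathcomp Require Import all_classical all_reals all_analysis.
From mathcomp Require Import lra.
Import Order.TTheory GRing.Theory Num.Theory.
Local Open Scope classical_set_scope.
Local Open Scope ring_scope.

(** Start the process at time [-N] from a point [x]. Its state at time [0] is
    [w_{s_0} o ... o w_{s_-N} x], and contraction on average bounds its expected
    distance to [Y_{-m,0}(s)] by [a^(m+1)] times a quantity bounded uniformly in
    [N], because the expected distance of the state to the base points satisfies
    [h_{n+1} <= a h_n + const]. With [b = sqrt a], Markov's inequality bounds the
    [P_x^{-N}]-probability that
    [d(Y^x_{-m,0}, Y^x_{-m-1,0}) + d(Y^x_{-m,0}, Y^y_{-m,0}) > b^m] for some [m]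
    in [[M, N)] by [b^M] times an affine function of the distances from [x] to
    the base points. As [nu] is tight along these distances, one can choose
    [M_0 < M_1 < ...] so that the event [D_n] belonging to [[M_n, M_{n+1})],
    measured at time [-M_{n+1}], has [Phi_{-M_{n+1}}(nu)]-measure at most
    [2^-(n+1)]. Off [\bigcup_{n >= k} D_n], which is open since each [D_n]
    depends on finitely many coordinates, the sequence [Y_{-m,0}] converges
    geometrically, and two sequences that agree on [(-r, r)] share
    [Y_{-(r-1),0}]. *)

Set Implicit Arguments.
Unset Strict Implicit.

(** * Finite words read from the past, and their cylinders *)

Section Words.
Variable E : Type.
Implicit Types (s : Sig E) (n m k j : nat) (es : seq E).

(* The letters [s_{-n}, ..., s_0], in the order in which the maps are applied. *)
Fixpoint word (s : Sig E) (n : nat) : seq E :=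
  if n is n'.+1 then s (- n%:Z) :: word s n' else [:: s 0].

Lemma size_word s n : size (word s n) = n.+1.
Proof. by elim: n => //= n ->. Qed.

(** Words run from the past towards time 0, so a later start gives a suffix. An event on [word s N]
    can thus speak of [Y] from every time [-m] with [m <= N]. *)
Lemma drop_word s n m : (m <= n)%N -> drop (n - m) (word s n) = word s m.
Proof.
elim: n => [|n IH]; first by rewrite leqn0 => /eqP ->.
rewrite leq_eqVlt => /predU1P[->|mn]; first by rewrite subnn drop0.
by rewrite subSn//= IH.
Qed.

Lemma nth_word s n k e0 : (k <= n)%N -> nth e0 (word s n) k = s (- n%:Z + k%:Z).
Proof.
elim: n k => [|n IH] [|k]//= kn; rewrite ?addr0//.
rewrite IH//; congr s.
by rewrite -[in RHS]addn1 -[in RHS](addn1 k) !PoszD opprD addrACA addNr addr0.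
Qed.

Lemma cyl_word s n : cyl (- n%:Z) (word s n) s.
Proof. by move=> k; rewrite size_word ltnS => kn e0; rewrite nth_word. Qed.

Lemma word_cyl s n es : size es = n.+1 -> cyl (- n%:Z) es s -> word s n = es.
Proof.
case: es => // e0 es sz h; apply: (@eq_from_nth _ e0); first by rewrite size_word.
by move=> k; rewrite size_word => kn; rewrite nth_word// (h k _ e0)// sz.
Qed.

Lemma eq_word s s' n :
  (forall j, (j <= n)%N -> s (- j%:Z) = s' (- j%:Z)) -> word s n = word s' n.
Proof.
elim: n => [|n IH] ss' /=; first by have := ss' 0%N isT; rewrite oppr0 => ->.
by rewrite ss'// IH// => j jn; apply: ss'; apply: leqW.
Qed.

End Words.

(** * Expectations of functions of finitely many letters *)

Section Expectation.
Variables (R : realType) (K : pointedType) (E : finType).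
Variables (w : E -> K -> K) (p : E -> K -> R).

Fixpoint words (L : nat) : seq (seq E) :=
  if L is L'.+1 then [seq e :: es | e <- enum E, es <- words L'] else [:: [::]].

Lemma mem_words L es : (es \in words L) = (size es == L).
Proof.
elim: L es => [|L IH] [|e es] //=.
- by apply/allpairsP => -[[e es] []].
- apply/allpairsP/idP => [[[e' es'] [_ /=]]|].
    by rewrite IH => /eqP <- [_ ->].
  by rewrite eqSS -IH => h; exists (e, es); rewrite mem_enum.
Qed.

(** Expectation of [f] over the first [L] letters of the process started at [x], conditioning on the
    first letter; this shape makes one-step estimates iterate by induction on [L]. *)
Fixpoint Eword (L : nat) (f : seq E -> R) (x : K) : R :=
  if L is L'.+1 then \sum_e p e x * Eword L' (fun es => f (e :: es)) (w e x)
  else f [::].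

Lemma Eword_words L f x : Eword L f x = \sum_(es <- words L) cylP w p x es * f es.
Proof.
elim: L f x => [|L IH] f x /=; first by rewrite big_seq1 mul1r.
rewrite big_allpairs_dep big_enum; apply: eq_bigr => e _.
rewrite IH mulr_sumr; apply: eq_bigr => es _.
by rewrite mulrA.
Qed.

Lemma Eword_sum L I (r : seq I) (F : I -> seq E -> R) x :
  Eword L (fun es => \sum_(i <- r) F i es) x = \sum_(i <- r) Eword L (F i) x.
Proof.
under [RHS]eq_bigr do rewrite Eword_words.
by rewrite Eword_words exchange_big; apply: eq_bigr => es _; rewrite mulr_sumr.
Qed.

Lemma EwordD L f g x : Eword L (fun es => f es + g es) x = Eword L f x + Eword L g x.
Proof.
rewrite !Eword_words -big_split; apply: eq_bigr => es _; exact: mulrDr.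
Qed.

Lemma EwordZ L c f x : Eword L (fun es => c * f es) x = c * Eword L f x.
Proof.
by rewrite !Eword_words mulr_sumr; apply: eq_bigr => es _; rewrite mulrCA.
Qed.

Hypothesis p_ge0 : forall e x, 0 <= p e x.

Lemma cylP_ge0 x es : 0 <= cylP w p x es.
Proof. by elim: es x => //= e es IH x; rewrite mulr_ge0. Qed.

Lemma Eword_le L f g x : (forall es, size es = L -> f es <= g es) ->
  Eword L f x <= Eword L g x.
Proof.
move=> fg; rewrite !Eword_words [leLHS]big_seq [leRHS]big_seq.
apply: ler_sum => es; rewrite mem_words => /eqP /fg.
exact: (ler_wpM2l (cylP_ge0 _ _)).
Qed.

Lemma Eword_1 L x : (forall x, \sum_e p e x = 1) -> Eword L (fun=> 1) x = 1.
Proof.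
move=> p1; elim: L x => //= L IH x; rewrite -[RHS](p1 x).
by apply: eq_bigr => e _; rewrite IH mulr1.
Qed.

End Expectation.
Arguments words {E} L.

(** * Upper bounds for [Pm], [Phim] and [Phi] by explicit covers *)

Section OuterMeasures.
Variables (R : realType) (K : pointedType) (E : finType).
Variables (w : E -> K -> K) (p : E -> K -> R).
Hypothesis p_ge0 : forall e x, 0 <= p e x.

Definition wordset (T : pred (seq E)) (N : nat) : set (Sig E) :=
  [set s | T (word s N)].

(** The finitely many accepted words, listed as a sequence and padded with [None], the empty set of
    zero mass, because covers in [Pm] are infinite sequences. *)
Definition wordcover (T : pred (seq E)) (N j : nat) : option (seq E) :=
  nth None [seq Some es | es <- words N.+1 & T es] j.

Lemma wordcoverP T N j :
  (exists es, [/\ wordcover T N j = Some es, size es = N.+1 & T es]) \/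
  wordcover T N j = None.
Proof.
rewrite /wordcover; set l := [seq es <- _ | _].
have [jl|lj] := ltnP j (size l); last by right; rewrite nth_default// size_map.
left; exists (nth [::] l j); rewrite (nth_map [::])//.
have : nth [::] l j \in l by exact: mem_nth.
by rewrite {2}/l mem_filter mem_words => /andP[? /eqP].
Qed.

Lemma wordset_cover T N :
  wordset T N = \bigcup_j ocyl (- N%:Z) (wordcover T N j).
Proof.
apply/seteqP; split=> [s Ts|s [j _]].
  set l := [seq es <- words N.+1 | T es].
  have sl : word s N \in l by rewrite mem_filter mem_words size_word eqxx Ts.
  exists (index (word s N) l) => //; rewrite /wordcover (nth_map [::]) ?index_mem//.
  by rewrite nth_index//; exact: cyl_word.
have [[es [-> sz Tes]]|->]// := wordcoverP T N j.
by move=> /= /word_cyl; rewrite /wordset/= => ->.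
Qed.

Lemma Asig_wordset T N : @Asig E (- N%:Z) (wordset T N).
Proof.
rewrite wordset_cover; apply: sigma_algebra_bigcup => j.
have [[es [-> sz Tes]]|->] := wordcoverP T N j; last exact: sigma_algebra0.
by apply: sub_sigma_algebra; exists es => // es0; move: sz; rewrite es0.
Qed.

Lemma ocylP_ge0 x c : 0 <= ocylP w p x c.
Proof. by case: c => //= es; exact: cylP_ge0. Qed.

Lemma Pm_ge0 m x (A : set (Sig E)) : (0 <= Pm w p m x A)%E.
Proof.
apply: le_ereal_inf_tmp => _ [c _ <-].
by apply: nneseries_ge0 => j _ _; rewrite lee_fin ocylP_ge0.
Qed.

Lemma Pm_set0 m x : Pm w p m x (@set0 (Sig E)) = 0%E.
Proof.
apply/eqP; rewrite eq_le Pm_ge0 andbT; apply: ereal_inf_lbound.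
by exists (fun=> None) => //; apply: eseries0.
Qed.

(** The cylinders of the accepted words form one admissible cover, and their masses add up to the
    expectation of the indicator. *)
Lemma Pm_wordset_le T N x :
  (Pm w p (- N%:Z) x (wordset T N) <= (Eword w p N.+1 (fun es => (T es)%:R) x)%:E)%E.
Proof.
apply: ereal_inf_lbound; exists (wordcover T N).
  by rewrite /= -wordset_cover.
set l := [seq es <- words N.+1 | T es].
rewrite (nneseries_split 0 (size l)); last by move=> j _; rewrite lee_fin ocylP_ge0.
rewrite add0n [X in (_ + X)%E]eseries0 ?adde0; last first.
  by move=> j lj _; rewrite /wordcover nth_default// size_map.
rewrite sumEFin Eword_words; congr EFin.
transitivity (\sum_(es <- l) cylP w p x es).
  rewrite (big_nth [::]); apply: eq_big_nat => j /andP[_ jl].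
  by rewrite /wordcover (nth_map [::]).
rewrite big_filter big_mkcond/=; apply: eq_bigr => es _.
by case: (T es); rewrite ?mulr1 ?mulr0.
Qed.

Variables (d : K -> K -> R) (nu : probability (Borel d) R).

(* [x |-> Pm w p m x A] is not known to be measurable here: the integral of a
   nonnegative function is a supremum over smaller simple functions, hence
   monotone in any case. *)
Lemma le_Phim m (A : set (Sig E)) (G : K -> \bar R) :
  (forall x, (Pm w p m x A <= G x)%E) -> (Phim w p nu m A <= \int[nu]_x G x)%E.
Proof.
move=> AG; have G0 x : (0 <= G x)%E by apply: le_trans (AG x); exact: Pm_ge0.
rewrite /Phim !ge0_integralTE//; last by move=> x; exact: Pm_ge0.
apply: ereal_sup_le => _ [h hA <-]; exists h => // x.
exact: le_trans (hA x) (AG x).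
Qed.

Lemma Phim_ge0 m (A : set (Sig E)) : (0 <= Phim w p nu m A)%E.
Proof. by apply: integral_ge0 => x _; exact: Pm_ge0. Qed.

Lemma Phim_set0 m : Phim w p nu m (@set0 (Sig E)) = 0%E.
Proof. by apply: integral0_eq => x _; exact: Pm_set0. Qed.

Lemma Phi_ge0 (A : set (Sig E)) : (0 <= Phi w p nu A)%E.
Proof.
apply: le_ereal_inf_tmp => _ [c _ <-].
by apply: nneseries_ge0 => j _ _; exact: Phim_ge0.
Qed.

Lemma le_Phi (A B : set (Sig E)) : A `<=` B -> (Phi w p nu A <= Phi w p nu B)%E.
Proof.
move=> AB; apply: ereal_inf_le_tmp => _ [c [cA Bc] <-]; exists c => //; split=> //.
exact: subset_trans Bc.
Qed.

(* A cover in the definition of [Phi] has one set for each start time, so the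
   start times [q n] have to be distinct. *)
Lemma Phi_bigcup_le (q : nat -> nat) (D : nat -> set (Sig E)) :
  injective q -> (forall n, @Asig E (- (q n)%:Z) (D n)) ->
  (Phi w p nu (\bigcup_n D n) <=
     \sum_(0 <= n <oo) Phim w p nu (- (q n)%:Z) (D n))%E.
Proof.
move=> qI AD.
(* The sets are regrouped by start time: injectivity of [q] leaves the single set [D n] at [q n],
   and times outside the range of [q] get the empty set. *)
pose A j := \bigcup_(n in [set n | q n = j]) D n.
have Aq n : A (q n) = D n.
  rewrite /A (_ : [set _ | _] = [set n]) ?bigcup_set1//.
  by apply/seteqP; split=> [m /qI//|m ->].
have A0 j : ~ range q j -> A j = set0.
  move=> jq; apply/seteqP; split=> // s [n nj _]; apply: jq.
  by exists n.
apply: (@le_trans _ _ (\sum_(0 <= j <oo) Phim w p nu (- j%:Z) (A j))%E).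
  apply: ereal_inf_lbound; exists A => //; split=> [j|s [n _ Ds]].
    have [[n _ <-]|/A0 ->] := pselect (range q j); first by rewrite Aq; exact: AD.
    exact: sigma_algebra0.
  by exists (q n) => //; rewrite Aq.
(* Unordered sums allow reindexing along [q], which need not be monotone. *)
rewrite !nneseries_esumT; [|by move=> ?; exact: Phim_ge0..].
under [leRHS]eq_esum do rewrite -Aq.
rewrite -(@esum_image _ _ _ setT q (fun j => Phim w p nu (- j%:Z) (A j))); last first.
  by move=> m n _ _ /qI.
rewrite [leRHS]esum_mkcond; apply: le_esum => j _.
case: ifPn => // /negP jq; rewrite A0 ?Phim_set0//.
by move=> h; apply: jq; rewrite inE.
Qed.

End OuterMeasures.

(** * Geometric sums and contraction on average *)

Lemma sum_geometric_le (R : realType) (b : R) M N : 0 < b -> b < 1 ->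
  \sum_(M <= i < N) b ^+ i <= b ^+ M / (1 - b).
Proof.
move=> b0 b1; have [MN|NM] := leqP M N; last first.
  by rewrite big_geq ?(ltnW NM)// divr_ge0 ?exprn_ge0 ?subr_ge0 ?(ltW b0) ?(ltW b1).
rewrite -(subnKC MN) geometric_partial_tail.
by apply: geometric_le_lim; rewrite ?gtr0_norm// exprn_ge0// ltW.
Qed.

Section Contraction.
Variables (R : realType) (K : pointedType) (d : K -> K -> R).
Variables (V E : finType) (ini ter : E -> V) (Kp : V -> set K).
Variables (w : E -> K -> K) (p : E -> K -> R) (a : R).
Hypothesis HCMS : CMS d ini ter Kp w p a.

Definition push (x : K) (es : seq E) : K := foldl (fun z e => w e z) x es.

(** [Y] as a function of the word alone. The value on the empty word is arbitrary, as [word s n] is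
    never empty. *)
Definition Yw (zs : V -> K) (es : seq E) : K :=
  push (if es is e :: _ then zs (ini e) else point) es.

Lemma YauxE s n z : Yaux w s n z = push z (word s n).
Proof. by elim: n z => //= n IH z; rewrite IH. Qed.

Lemma Y_Yw zs s n : Y ini w zs n s = Yw zs (word s n).
Proof. by rewrite /Y YauxE /Yw; case: n. Qed.

Lemma vertex_exists x : exists v, Kp v x.
Proof. by case: HCMS => _ [_ _ + _] _ _ _; apply. Qed.

Definition vtx (x : K) : V := projT1 (cid (vertex_exists x)).

Lemma vtxP x : Kp (vtx x) x.
Proof. by rewrite /vtx; case: cid. Qed.

Lemma Kp_inj v v' x : Kp v x -> Kp v' x -> v = v'.
Proof.
case: HCMS => _ [_ disj _ _] _ _ _ vx v'x.
apply: contrapT => /disj D.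
by have : (Kp v `&` Kp v') x by []; rewrite D.
Qed.

Let p0 e x : 0 <= p e x. Proof. by case: HCMS => _ _ _ [_ + _ _] _; apply. Qed.
Let p1 x : \sum_e p e x = 1. Proof. by case: HCMS => _ _ _ [_ _ + _] _; apply. Qed.
Let d0 x y : 0 <= d x y. Proof. by case: HCMS => -[[+ _ _ _] _] _ _ _ _; apply. Qed.
Let dC x y : d x y = d y x. Proof. by case: HCMS => -[[_ _ + _] _] _ _ _ _; apply. Qed.
Let dT x y z : d x z <= d x y + d y z.
Proof. by case: HCMS => -[[_ _ _ +] _] _ _ _ _; apply. Qed.
Let a0 : 0 < a. Proof. by case: HCMS => _ _ _ _ []. Qed.
Let a1 : a < 1. Proof. by case: HCMS => _ _ _ _ []. Qed.
Let wK e x : Kp (ini e) x -> Kp (ter e) (w e x).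
Proof. by case: HCMS => _ _ [_ +] _ _; apply. Qed.
Let pK e x : p e x <> 0 -> Kp (ini e) x.
Proof. by case: HCMS => _ _ _ [_ _ _ h] _ px; apply: contrapT => /h. Qed.
Let contr v x y : Kp v x -> Kp v y ->
  \sum_e p e x * d (w e x) (w e y) <= a * d x y.
Proof. by case: HCMS => _ _ _ _ [_ _]; apply. Qed.

(** Edges that do not start in the cell of [x] have weight zero, so the comparison is only required
    on the others. *)
Lemma sum_p_le x (f g : E -> R) :
  (forall e, Kp (ini e) x -> f e <= g e) ->
  \sum_e p e x * f e <= \sum_e p e x * g e.
Proof.
move=> fg; apply: ler_sum => e _; have [->|/eqP px] := eqVneq (p e x) 0.
  by rewrite !mul0r.
by rewrite ler_wpM2l//; apply/fg/pK.
Qed.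

(** After a letter of positive weight both points lie again in one common cell, so the one-step
    contraction, weighted by the probabilities at [x], iterates. *)
Lemma Eword_contraction L v x y : Kp v x -> Kp v y ->
  Eword w p L (fun es => d (push x es) (push y es)) x <= a ^+ L * d x y.
Proof.
elim: L v x y => [|L IH] v x y vx vy /=; first by rewrite mul1r.
apply: (@le_trans _ _ (\sum_e p e x * (a ^+ L * d (w e x) (w e y)))).
  apply: sum_p_le => e ex; apply: (IH (ter e)); apply: wK => //.
  by rewrite (Kp_inj ex vx).
under eq_bigr do rewrite mulrCA.
by rewrite -mulr_sumr exprSr -mulrA (ler_wpM2l (exprn_ge0 _ (ltW a0)))//; apply: contr vx vy.
Qed.

(** * Expected distance of the process to the base points *)

Section BasePoints.
Variable zs : V -> K.
Hypothesis Hzs : forall v, Kp v (zs v).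

Definition basedist (x : K) : R := d x (zs (vtx x)).

(** Fixed point of the affine recursion [h = a * h + const], where the constant sums the
    displacements of the base points over all edges. *)
Definition drift : R :=
  (\sum_e d (w e (zs (ini e))) (zs (ter e))) / (1 - a).

Lemma basedist_ge0 x : 0 <= basedist x. Proof. exact: d0. Qed.

Lemma drift_ge0 : 0 <= drift.
Proof. by rewrite divr_ge0 ?sumr_ge0// subr_ge0 ltW. Qed.

Lemma basedist_step x :
  \sum_e p e x * basedist (w e x) <= a * basedist x + (1 - a) * drift.
Proof.
have -> : (1 - a) * drift = \sum_e d (w e (zs (ini e))) (zs (ter e)).
  by rewrite mulrC divfK// subr_eq0 gt_eqF.
apply: (@le_trans _ _ (\sum_e p e x * (d (w e x) (w e (zs (vtx x))) +
    d (w e (zs (ini e))) (zs (ter e))))).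
  apply: sum_p_le => e ex; rewrite /basedist.
  rewrite (Kp_inj (vtxP x) ex) (Kp_inj (vtxP (w e x)) (wK ex)).
  exact: dT.
under eq_bigr do rewrite mulrDr.
rewrite big_split lerD//=; first exact: contr (vtxP x) (Hzs _).
(* Each weight [p e x] is at most 1, since the weights sum to 1. *)
apply: ler_sum => e _; rewrite ler_piMl// -(p1 x) (bigD1 e)//= lerDl.
exact: sumr_ge0.
Qed.

(** The first [k] letters move only [x]; iterating [basedist_step] over them gives the convex
    combination of [basedist] and [drift]. The last [m.+1] letters move both points, which start in
    the same cell, and contribute [a ^+ m.+1]. *)
Lemma Eword_dist_Yw k m x :
  Eword w p (k + m.+1) (fun es => d (push x es) (Yw zs (drop k es))) x
    <= a ^+ m.+1 * (a ^+ k * basedist x + (1 - a ^+ k) * drift).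
Proof.
elim: k x => [|k IH] x.
  rewrite add0n mul1r subrr mul0r addr0 /=.
  apply: (@le_trans _ _ (\sum_e p e x * (a ^+ m * d (w e x) (w e (zs (vtx x)))))).
    apply: sum_p_le => e ex; rewrite (Kp_inj (vtxP x) ex).
    exact: (Eword_contraction m (wK ex) (wK (Hzs (ini e)))).
  under eq_bigr do rewrite mulrCA.
  rewrite -mulr_sumr exprSr -mulrA (ler_wpM2l (exprn_ge0 _ (ltW a0)))//.
  exact: contr (vtxP x) (Hzs _).
rewrite addSn /=.
apply: (@le_trans _ _ (\sum_e p e x * (a ^+ m.+1 *
    (a ^+ k * basedist (w e x) + (1 - a ^+ k) * drift)))).
  by apply: sum_p_le => e ex; apply: IH.
under eq_bigr do rewrite mulrCA.
rewrite -mulr_sumr (ler_wpM2l (exprn_ge0 _ (ltW a0)))//.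
under eq_bigr do rewrite mulrDr mulrCA.
rewrite big_split/= -mulr_sumr -mulr_suml p1 mul1r.
have := ler_wpM2l (exprn_ge0 k (ltW a0)) (basedist_step x).
rewrite exprS; lra.
Qed.

Lemma Eword_dist_Y N m x : (m <= N)%N ->
  Eword w p N.+1 (fun es => d (push x es) (Yw zs (drop (N - m) es))) x
    <= a ^+ m.+1 * (basedist x + drift).
Proof.
move=> mN; have := Eword_dist_Yw (N - m) m x; rewrite addnS subnK// => /le_trans; apply.
rewrite (ler_wpM2l (exprn_ge0 _ (ltW a0)))//.
have := basedist_ge0 x; have := drift_ge0.
have : 0 <= a ^+ (N - m) by rewrite exprn_ge0// ltW.
have : a ^+ (N - m) <= 1 by rewrite exprn_ile1// ltW.
nra.
Qed.

End BasePoints.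

(** * Exceptional events and their probabilities *)

Variables xs ys : V -> K.
Hypotheses (Hxs : forall v, Kp v (xs v)) (Hys : forall v, Kp v (ys v)).

(** The square root balances Markov's inequality: a mean of order [a ^+ m] against the threshold
    [rate ^+ m] leaves a probability of order [rate ^+ m]. *)
Definition rate : R := Num.sqrt a.

Lemma rate_gt0 : 0 < rate. Proof. by rewrite sqrtr_gt0. Qed.

Lemma rate_lt1 : rate < 1.
Proof. by rewrite -[ltRHS]sqrtr1 ltr_sqrt. Qed.

Lemma rate_sqr : rate ^+ 2 = a. Proof. by rewrite sqr_sqrtr// ltW. Qed.

Definition gap (m N : nat) (es : seq E) : R :=
  let Ym zs m := Yw zs (drop (N - m) es) in
  d (Ym xs m) (Ym xs m.+1) + d (Ym xs m) (Ym ys m).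

Definition bad (M N : nat) (es : seq E) : bool :=
  has (fun m => rate ^+ m < gap m N es) (index_iota M N).

Lemma gap_word s m N : (m < N)%N -> gap m N (word s N) =
  d (Y ini w xs m s) (Y ini w xs m.+1 s) + d (Y ini w xs m s) (Y ini w ys m s).
Proof. by move=> mN; rewrite /gap !Y_Yw !drop_word// ltnW. Qed.

Definition potential (x : K) : R :=
  basedist xs x + drift xs + (basedist ys x + drift ys).

(** Triangle inequalities through the state [push x es] give four distances of the kind in
    [Eword_dist_Y]. The strict [m < N] ensures that the word also determines [Y] from time
    [-m.+1]. *)
Lemma Eword_gap m N x : (m < N)%N ->
  Eword w p N.+1 (gap m N) x <= 4 * a ^+ m.+1 * potential x.
Proof.
move=> mN; pose D zs m es := d (push x es) (Yw zs (drop (N - m) es)).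
have gapD es : gap m N es <= (D xs m es + D xs m.+1 es) + (D xs m es + D ys m es).
  by rewrite /gap lerD// /D [d (push _ _) _]dC; apply: dT.
apply: le_trans (Eword_le _ p0 _ (fun es _ => gapD es)) _; rewrite !EwordD.
have X := Eword_dist_Y Hxs x (ltnW mN).
have X' := Eword_dist_Y Hxs x mN.
have Z := Eword_dist_Y Hys x (ltnW mN).
have x0 := basedist_ge0 xs x; have y0 := basedist_ge0 ys x.
have cx0 := drift_ge0 xs; have cy0 := drift_ge0 ys.
have am0 : 0 < a ^+ m.+1 by rewrite exprn_gt0.
have am1 : a ^+ m.+2 <= a ^+ m.+1 by rewrite exprS ler_piMl// ltW.
rewrite /potential /D.
have X'' := le_trans X' (ler_wpM2r (addr_ge0 x0 cx0) am1).
have := mulr_ge0 (ltW am0) (addr_ge0 x0 cx0).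
have := mulr_ge0 (ltW am0) (addr_ge0 y0 cy0).
lra.
Qed.

Lemma Eword_bad M N x :
  Eword w p N.+1 (fun es => (bad M N es)%:R) x <=
    rate ^+ M * (4 / (1 - rate) * potential x).
Proof.
have b0 := rate_gt0; have b1 := rate_lt1.
have bm0 m : 0 < rate ^+ m by rewrite exprn_gt0.
have gap0 m es : 0 <= gap m N es by rewrite addr_ge0.
have P0 : 0 <= potential x.
  by rewrite !addr_ge0 ?basedist_ge0 ?drift_ge0.
(* Markov's inequality and the union bound in one: the indicator is at most the sum of the gaps
   divided by their thresholds. *)
apply: (@le_trans _ _ (Eword w p N.+1
    (fun es => \sum_(m <- index_iota M N) (rate ^+ m)^-1 * gap m N es) x)).
  apply: Eword_le => // es _; have S0 s0 :
    0 <= \sum_(m <- s0) (rate ^+ m)^-1 * gap m N es.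
    by apply: sumr_ge0 => m _; rewrite mulr_ge0// invr_ge0 ltW.
  rewrite /bad; case: hasP => [[m mi gm]|_]; last exact: S0.
  rewrite (big_rem m)//= -[leLHS]addr0 lerD ?S0//.
  by rewrite mulrC ler_pdivlMr// mul1r ltW.
rewrite Eword_sum.
apply: (@le_trans _ _ (\sum_(M <= m < N) rate ^+ m * (4 * potential x))).
  rewrite [leLHS]big_nat [leRHS]big_nat; apply: ler_sum => m /andP[_ mN].
  rewrite EwordZ mulrC ler_pdivrMr//; apply: (le_trans (Eword_gap x mN)).
  rewrite [4 * a ^+ _]mulrC -mulrA [leRHS]mulrAC ler_wpM2r ?mulr_ge0//.
  (* Here [a ^+ m.+1] is [rate ^+ (2 * m.+1)], which is at most [rate ^+ (m + m)]. *)
  rewrite -exprD -rate_sqr -exprM ler_wiXn2l ?(ltW b0) ?(ltW b1)//.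
  by rewrite mul2n -addnn leq_add.
rewrite -mulr_suml [4 / _]mulrC -[X in _ <= _ * X]mulrA [leRHS]mulrA ler_wpM2r ?mulr_ge0//.
exact: sum_geometric_le.
Qed.

(** * Integration of the bounds against [nu] *)

Variable nu : probability (Borel d) R.

Lemma dopen_measurable (U : set K) : dopen d U -> measurable (U : set (Borel d)).
Proof. exact: sub_sigma_algebra. Qed.

(** On each cell [potential] agrees with a function continuous on all of [K], so the set is a finite
    union of cells intersected with open sets. *)
Lemma potential_measurable (t : R) :
  measurable ([set x | t < potential x] : set (Borel d)).
Proof.
pose c := drift xs + drift ys.
have -> : [set x | t < potential x] = \bigcup_(v in [set: V])
    (Kp v `&` [set x | t < d x (xs v) + d x (ys v) + c]).
  have potE v x : Kp v x -> potential x = d x (xs v) + d x (ys v) + c.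
    move=> vx; rewrite /potential /basedist (Kp_inj (vtxP x) vx) /c.
    lra.
  apply/seteqP; split=> [x /= tx|x [v _ [vx] /=]]; last by rewrite -(potE v).
  by exists (vtx x) => //; have vx := vtxP x; rewrite /= -potE.
apply: fin_bigcup_measurable => [|v _]; first exact: finite_finset.
apply: measurableI.
  by case: HCMS => _ [_ _ _ +] _ _ _; apply.
apply: dopen_measurable => x /= tx.
(* Half the margin, because two distances vary with the point. *)
exists ((d x (xs v) + d x (ys v) + c - t) / 2) => [|y xy].
  by rewrite divr_gt0// subr_gt0.
have := dT x y (xs v); have := dT x y (ys v); lra.
Qed.

(** The threshold [M0] does not depend on [N]: outside a set of small [nu]-measure [potential] is
    bounded, and there [Eword_bad] is uniform in [N]. *)
Lemma Phim_bad (eps : R) : 0 < eps -> exists M0, forall M N, (M0 <= M)%N ->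
  (Phim w p nu (- N%:Z) (wordset (bad M N) N) <= eps%:E)%E.
Proof.
move=> eps0.
(* The superlevel sets decrease to the empty set, so their measure tends to 0 by continuity from
   above. *)
pose F j : set (Borel d) := [set x | j%:R < potential x].
have mF j : measurable (F j) by exact: potential_measurable.
have capF : \bigcap_j F j = set0.
  apply/seteqP; split=> // x /(_ (Num.trunc (potential x)).+1 I).
  by rewrite /F/= ltNge ltW// truncnS_gt.
have [j Fj] : exists j, (nu (F j) < (eps / 2)%:E)%E.
  have : (nu \o F) n @[n --> \oo] --> nu (\bigcap_j F j).
    apply: nonincreasing_cvg_mu => //.
    - by rewrite (le_lt_trans (probability_le1 _ _))// ltry.
    - by rewrite capF; exact: measurable0.
    - move=> m n mn; apply/subsetPset => x; rewrite /F/=; apply: le_lt_trans.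
      by rewrite ler_nat.
  rewrite capF measure0 => /fine_cvgP[[n0 _ fin] /cvgrPdist_lt /(_ (eps / 2))].
  case=> [|n1 _ lt]; first by rewrite divr_gt0.
  exists (maxn n0 n1); have := lt (maxn n0 n1) (leq_maxr _ _).
  rewrite /= sub0r normrN => /(le_lt_trans (ler_norm _)).
  by rewrite -lte_fin fineK//; exact: fin (leq_maxl _ _).
have b0 := rate_gt0; have b1 := rate_lt1.
pose c := 4 / (1 - rate) * j%:R.
have c0 : 0 <= c by rewrite mulr_ge0// divr_ge0// subr_ge0 ltW.
have [M0 HM0] : exists M0, forall M, (M0 <= M)%N -> rate ^+ M * c <= eps / 2.
  (* Adding 1 keeps the divisor positive, as [c] vanishes for [j = 0]. *)
  have /cvgrPdist_lt /(_ (eps / 2 / (c + 1))) : rate ^+ n @[n --> \oo] --> 0.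
    by apply: cvg_expr; rewrite gtr0_norm.
  case=> [|n0 _ lt]; first by rewrite !divr_gt0// ltr_wpDl.
  exists n0 => M /lt /=; rewrite sub0r normrN ger0_norm; last by rewrite exprn_ge0// ltW.
  rewrite ltr_pdivlMr; last by rewrite ltr_wpDl.
  by move=> /ltW; apply: le_trans; rewrite ler_wpM2l ?exprn_ge0 ?(ltW b0)// lerDl.
exists M0 => M N /HM0 HM.
(* On [F j] the probability is bounded by 1, elsewhere by [eps / 2]. *)
apply: (@le_trans _ _ (\int[nu]_x ((\1_(F j) x)%:E + (eps / 2)%:E))%E).
  apply: le_Phim => // x; apply: le_trans (Pm_wordset_le _ p0 _ _ _) _ => //.
  rewrite -EFinD lee_fin indicE; have [_|] := boolP (x \in F j).
    rewrite -[leLHS]addr0 lerD ?divr_ge0 ?(ltW eps0)//.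
    rewrite -[leRHS](Eword_1 w N.+1 x p1); apply: Eword_le => // es _.
    by case: bad.
  rewrite notin_setE /F/= => /negP; rewrite -leNgt => xj.
  rewrite add0r (le_trans (Eword_bad _ _ _))// (le_trans _ HM)//.
  rewrite ler_wpM2l ?exprn_ge0 ?(ltW b0)// ler_wpM2l// divr_ge0// subr_ge0 ltW//.
rewrite ge0_integralD//=.
- rewrite integral_indic// setIT integral_cst// [X in (_ * X)%E](_ : _ = 1%E); last exact: probability_setT.
  by rewrite mule1 [in leRHS](splitr eps) EFinD leeD2r// ltW.
- by apply/measurable_realfun.measurable_EFinP; exact: measurable_realfun.measurable_indic.
- by move=> x _; rewrite lee_fin divr_ge0// ltW.
Qed.

End Contraction.

(** * The shift metric and agreement of words *)

Section ShiftMetric.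
Variables (R : realType) (E : finType).
Implicit Types s : Sig E.

Lemma dSig_words s s' :
  (@dSig R E s s' = 0 /\ forall n, word s n = word s' n) \/
  exists r, @dSig R E s s' = (2^-1) ^+ r /\
            forall n, (n < r)%N -> word s n = word s' n.
Proof.
rewrite /dSig; case: pselect => [H|nH].
  right; case: ex_minnP => r _ rmin; exists r; split=> // n nr.
  apply: eq_word => j jn; apply/eqP; apply: contraT => sj.
  have := leq_ltn_trans jn nr; rewrite ltnNge => /negP[].
  by apply: rmin; rewrite sj orbT.
left; split=> // n; apply: eq_word => j _; apply/eqP; apply: contraT => sj.
by exfalso; apply: nH; exists j; rewrite sj orbT.
Qed.

Lemma half_exp_le m n : ((2^-1 : R) ^+ m <= 2^-1 ^+ n) = (n <= m)%N.
Proof. by rewrite ler_iXn2l// ?invr_gt0// invf_lt1// ltr1n. Qed.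

Lemma dSig_le_word s s' n :
  @dSig R E s s' <= (2^-1) ^+ n.+1 -> word s n = word s' n.
Proof.
by case: (dSig_words s s') => [[_ //]|[r [-> sw]]]; rewrite half_exp_le => /sw.
Qed.

Lemma dopen_wordset (T : pred (seq E)) n : dopen (@dSig R E) (wordset T n).
Proof.
move=> s Ts; exists (2^-1 ^+ n.+1); first by rewrite exprn_gt0// invr_gt0.
by move=> s' /ltW /dSig_le_word ss'; rewrite /wordset/= -ss'.
Qed.

End ShiftMetric.

(** * Sequences with geometrically small steps *)

Section GeometricSequences.
Variables (R : realType) (K : Type) (d : K -> K -> R) (b : R).
Hypotheses (dm : is_metric d) (b0 : 0 < b) (b1 : b < 1).
Variables (u : nat -> K) (M : nat).
Hypothesis u_step : forall m, (M <= m)%N -> d (u m) (u m.+1) <= b ^+ m.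

Lemma geometric_dist m n : (M <= m <= n)%N -> d (u m) (u n) <= b ^+ m / (1 - b).
Proof.
case: dm => _ d_eq _ dT; move=> /andP[Mm mn].
apply: le_trans (sum_geometric_le m n b0 b1); elim: n mn => [|n IH].
  by rewrite leqn0 => /eqP ->; rewrite big_geq// (d_eq _ _).2.
rewrite leq_eqVlt => /predU1P[->|mn]; first by rewrite big_geq// (d_eq _ _).2.
rewrite big_nat_recr//=; apply: le_trans (dT _ (u n) _) _.
by rewrite lerD ?IH// u_step// (leq_trans Mm).
Qed.

Lemma geometric_dist_lim m y : (M <= m)%N -> dcvg d u y ->
  d (u m) y <= b ^+ m / (1 - b).
Proof.
case: dm => _ _ _ dT Mm uy; apply/ler_addgt0Pr => e /uy[n0 un].
apply: le_trans (dT _ (u (maxn m n0)) _) _.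
by rewrite lerD ?geometric_dist ?Mm ?leq_maxl// ltW// un// leq_maxr.
Qed.

Lemma geometric_tail_lt (eps : R) : 0 < eps ->
  exists n0, forall n, (n0 <= n)%N -> b ^+ n / (1 - b) < eps.
Proof.
move=> e0; have b10 : 0 < 1 - b by rewrite subr_gt0.
have /cvgrPdist_lt /(_ (eps * (1 - b))) : b ^+ n @[n --> \oo] --> 0.
  by apply: cvg_expr; rewrite gtr0_norm.
case=> [|n0 _ lt]; first by rewrite mulr_gt0.
exists n0 => n /lt /=; rewrite sub0r normrN gtr0_norm ?exprn_gt0//.
by rewrite ltr_pdivrMr.
Qed.

Lemma geometric_dcauchy : dcauchy d u.
Proof.
move=> e e0; have [n0 n0P] := geometric_tail_lt e0.
exists (maxn M n0) => n k; rewrite !geq_max => /andP[Mn n0n] /andP[Mk n0k].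
have [nk|/ltnW kn] := leqP n k.
  by rewrite (le_lt_trans (@geometric_dist n k _))// ?n0P// Mn.
case: dm => _ _ -> _.
by rewrite (le_lt_trans (@geometric_dist k n _))// ?n0P// Mk.
Qed.

Lemma dcvg_close (v : nat -> K) y :
  (forall m, (M <= m)%N -> d (u m) (v m) <= b ^+ m) -> dcvg d u y -> dcvg d v y.
Proof.
case: dm => _ _ dC dT uv uy e e0; have e20 : 0 < e / 2 by rewrite divr_gt0.
have [n0 n0P] := geometric_tail_lt e20; have [n1 n1P] := uy _ e20.
exists (maxn M (maxn n0 n1)) => n; rewrite !geq_max => /and3P[Mn n0n n1n].
apply: le_lt_trans (dT _ (u n) _) _; rewrite [ltRHS]splitr ltrD ?n1P// dC.
apply: le_lt_trans (uv _ Mn) (le_lt_trans _ (n0P _ n0n)).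
rewrite ler_pdivlMr ?subr_gt0// ler_piMr ?exprn_ge0 ?(ltW b0)//.
by rewrite lerBlDr lerDl ltW.
Qed.

End GeometricSequences.

(** The exponent is the base-2 logarithm of [1 / b], chosen so that 1/2 raised to it is [b]. *)
Lemma half_powR (R : realType) (b : R) r : 0 < b ->
  (2^-1 ^+ r) `^ (- ln b / ln 2) = b ^+ r.
Proof.
move=> b0; have l2 : ln (2 : R) != 0 by rewrite gt_eqF// ln_gt0// ltr1n.
have h0 : 0 < (2^-1 : R) ^+ r by rewrite exprn_gt0// invr_gt0.
rewrite /powR gt_eqF// lnXn ?invr_gt0// lnV ?posrE//.
by rewrite mulrnAr mulrN divfK// opprK -lnXn// lnK// posrE exprn_gt0.
Qed.

(** * Choice of the blocks and of the sets [Q k], and the three claims *)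

Unset Implicit Arguments.
Set Strict Implicit.

Theorem theorem1 (R : realType) (K : pointedType) (d : K -> K -> R)
  (V E : finType) (ini ter : E -> V) (Kp : V -> set K)
  (w : E -> K -> K) (p : E -> K -> R) (a : R)
  (HCMS : CMS d ini ter Kp w p a)
  (Hdini : forall e, dini_on d (Kp (ini e)) (p e))
  (delta : R) (Hdelta : 0 < delta)
  (Hpdelta : forall e x, Kp (ini e) x -> delta <= p e x)
  (xs ys : V -> K) (Hxs : forall v, Kp v (xs v)) (Hys : forall v, Kp v (ys v))
  (nu : probability (Borel d) R) :
  [/\ (* (i) *)
      (exists B : set (Sig E), Phi w p nu B = 0%E /\
         forall s, ~ B s -> exists y, Fcode d ini w xs s y),
      (* (ii) *)
      (exists B : set (Sig E), Phi w p nu B = 0%E /\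
         forall s, ~ B s -> exists y, Fcode d ini w xs s y /\ Fcode d ini w ys s y) &
      (* (iii) *)
      exists Q : nat -> set (Sig E),
        [/\ forall k, dclosed (@dSig R E) (Q k),
            forall k, Q k `<=` Q k.+1,
            (Phi w p nu (~` Q k) @[k --> \oo] --> 0%E) &
            exists alpha C : R, [/\ 0 < alpha, 0 < C &
              forall k, exists2 dk : R, 0 < dk &
                (forall s, Q k s -> exists y, Fcode d ini w xs s y) /\
                (forall s s' y y', Q k s -> Q k s' -> @dSig R E s s' <= dk ->
                   Fcode d ini w xs s y -> Fcode d ini w xs s' y' ->
                   d y y' <= C * @dSig R E s s' `^ alpha)]]].
Proof.
have p0 e x : 0 <= p e x by case: HCMS => _ _ _ [_ + _ _] _; apply.
have [dm dcomplete] : is_complete_metric d by case: HCMS.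
have [d0 d_eq dC dT] := dm.
set b := rate a; have b0 : 0 < b := rate_gt0 HCMS; have b1 : b < 1 := rate_lt1 HCMS.
have b10 : 0 < 1 - b by rewrite subr_gt0.
have half0 : 0 < (2^-1 : R) by rewrite invr_gt0.
have half1 : (2^-1 : R) < 1 by rewrite invf_lt1// ltr1n.
have [f fP] : {f : nat -> nat & forall n M N, (f n <= M)%N ->
    (Phim w p nu (- N%:Z) (wordset (bad d ini w a xs ys M N) N)
       <= (1 / (2 ^ n.+1)%:R : R)%:E)%E}.
  apply: (@choice _ _ (fun n m => forall M N, (m <= M)%N -> (Phim w p nu _ _ <= _)%E)).
  move=> n; apply: (Phim_bad HCMS Hxs Hys).
  by rewrite divr_gt0// ltr0n expn_gt0.
(* The sum makes [M n] at least [f n]; the summand [n] makes [M] strictly increasing, so that the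
   start times are distinct. *)
pose M n := (n + \sum_(i < n.+1) f i)%N.
have MS n : (M n < M n.+1)%N by rewrite /M [in ltnRHS]big_ord_recr/= addSn ltnS addnA leq_addr.
have Mmono : {mono M : m n / (m <= n)%N}.
  by apply: leq_mono; exact: homo_ltn ltn_trans MS.
have fM n : (f n <= M n)%N by rewrite /M big_ord_recr/= addnA leq_addl.
pose D n := wordset (bad d ini w a xs ys (M n) (M n.+1)) (M n.+1).
pose Q k := ~` \bigcup_n D (n + k)%N.
have Qle k : (Phi w p nu (~` Q k) <= ((2^-1 : R) ^+ k)%:E)%E.
  rewrite setCK; apply: le_trans.
    apply: (@Phi_bigcup_le _ _ _ _ _ p0 _ _ (fun n => M (n + k).+1)).
      by move=> m n /(incn_inj Mmono)/eqP; rewrite eqSS eqn_add2r => /eqP.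
    by move=> n; exact: Asig_wordset.
  (* The bounds [2^-(n+k+1)] sum over [n] to [2^-k]. *)
  rewrite exprVn -[(2 ^+ k)^-1]div1r.
  rewrite -(cvg_lim _ (@cvg_geometric_eseries_half R 1 k))//.
  apply: lee_nneseries => n; first by move=> _ _; exact: Phim_ge0.
  by move=> _; rewrite addnS; apply: fP.
have Qstep k s m : Q k s -> (M k <= m)%N ->
    d (Y ini w xs m s) (Y ini w xs m.+1 s) + d (Y ini w xs m s) (Y ini w ys m s)
      <= b ^+ m.
  move=> Qs Mm; rewrite leNgt; apply/negP => bm; apply: Qs.
  (* The blocks from index [k] on cover all [m >= M k], so a violation at [m] puts [s] into one of
     the removed events. *)
  have [n /andP[Mn mM]] : exists n, (M (n + k) <= m < M (n + k).+1)%N.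
    elim: m Mm {bm} => [|m IH] Mm.
      exists 0%N; rewrite add0n Mm/=; exact: leq_ltn_trans (MS k).
    have [/IH[n /andP[Mn mM]]|mM] := leqP (M k) m; last first.
      by exists 0%N; rewrite add0n Mm/= (leq_ltn_trans mM).
    have [h|h] := ltnP m.+1 (M (n + k).+1); first by exists n; rewrite h leqW.
    by exists n.+1; rewrite addSn h/= (leq_ltn_trans mM).
  exists n => //; apply/hasP; exists m; first by rewrite mem_index_iota Mn.
  by rewrite gap_word.
have Qx k s m : Q k s -> (M k <= m)%N ->
    d (Y ini w xs m s) (Y ini w xs m.+1 s) <= b ^+ m.
  by move=> Qs Mm; apply: le_trans (Qstep _ _ _ Qs Mm); rewrite lerDl.
have Qy k s m : Q k s -> (M k <= m)%N ->
    d (Y ini w xs m s) (Y ini w ys m s) <= b ^+ m.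
  by move=> Qs Mm; apply: le_trans (Qstep _ _ _ Qs Mm); rewrite lerDr.
have Qcvg k s : Q k s -> exists y, Fcode d ini w xs s y.
  move=> Qs; apply: dcomplete.
  by apply: (geometric_dcauchy dm b0 b1 (M := M k)) => m; exact: Qx.
pose B := \bigcap_k ~` Q k.
have PhiB : Phi w p nu B = 0%E.
  apply/eqP; rewrite eq_le Phi_ge0// andbT; apply/lee_addgt0Pr => e e0.
  have [k kP] := geometric_tail_lt half0 half1 e0.
  rewrite add0e (le_trans (le_Phi _ _ _ (_ : B `<=` ~` Q k)))//.
    exact: bigcap_inf.
  rewrite (le_trans (Qle k))// lee_fin (le_trans _ (ltW (kP k _)))//.
  by rewrite ler_pdivlMr ?subr_gt0// ler_piMr ?exprn_ge0 ?(ltW half0)// lerBlDr lerDl ltW.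
have BQ s : ~ B s -> exists k, Q k s.
  move=> Bs; apply: contrapT => nQ; apply: Bs => k _ Qs.
  by apply: nQ; exists k.
split.
- by exists B; split=> // s /BQ[k /Qcvg].
- exists B; split=> // s /BQ[k Qs]; have [y sy] := Qcvg _ _ Qs.
  exists y; split=> //.
  by apply: (dcvg_close dm b0 b1 (M := M k) _ sy) => m; exact: Qy.
exists Q; split.
- move=> k; rewrite /dclosed setCK => s [n _ Dn].
  have [r r0 rP] := @dopen_wordset R _ _ _ _ Dn.
  by exists r => // s' /rP ?; exists n.
- move=> k s Qs [n _ Dn]; apply: Qs; exists n.+1 => //.
  by rewrite addSnnS.
- apply: (@squeeze_cvge _ _ _ _ (cst 0%E) _ (fun k => ((2^-1 : R) ^+ k)%:E)).
  + by near=> k; rewrite Phi_ge0//= Qle.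
  + exact: cvg_cst.
  + by apply: cvg_EFin; [near=> k|apply: cvg_expr; rewrite gtr0_norm].
(* In [C], the 2 counts the tails of both sequences and [1 - b] sums each tail; the factor [b] in
   the denominator compensates that distance [2^-(r+1)] gives agreement of words only up to index
   [r]. *)
exists (- ln b / ln 2), (2 / (b * (1 - b))); split.
- by rewrite divr_gt0 ?oppr_gt0 ?ln_lt0 ?b0// ln_gt0// ltr1n.
- by rewrite divr_gt0// mulr_gt0.
(* This radius forces agreement at least up to [M k], where the geometric estimates on [Q k]
   begin. *)
move=> k; exists (2^-1 ^+ (M k).+1); first by rewrite exprn_gt0.
split; first exact: Qcvg.
move=> s s' y y' Qs Qs' ss' sy sy'.
have close n : (M k <= n)%N -> word s n = word s' n ->
    d y y' <= 2 * (b ^+ n / (1 - b)).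
  move=> Mn wn; have Yn : Y ini w xs n s = Y ini w xs n s' by rewrite !Y_Yw wn.
  have := geometric_dist_lim dm b0 b1 (Qx _ _ ^~ Qs) Mn sy.
  have := geometric_dist_lim dm b0 b1 (Qx _ _ ^~ Qs') Mn sy'.
  have := dT y (Y ini w xs n s) y'; rewrite (dC y (Y _ _ _ _ _)) -Yn; lra.
have [[-> ww']|[[|r] [dE ww']]] := dSig_words R s s'.
(* At distance zero the words agree for every [n], so [close] makes [d y y'] arbitrarily small. *)
- rewrite powR0 ?mulr0; last by rewrite gt_eqF// divr_gt0 ?oppr_gt0 ?ln_lt0 ?b0// ln_gt0// ltr1n.
  apply/ler_addgt0Pr => e e0; have e20 : 0 < e / 2 by rewrite divr_gt0.
  have [n nP] := geometric_tail_lt b0 b1 e20.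
  have := close (maxn (M k) n) (leq_maxl _ _) (ww' _).
  have := nP _ (leq_maxr (M k) n); lra.
- by move: ss'; rewrite dE half_exp_le.
move: ss'; rewrite dE half_exp_le ltnS half_powR// => Mr.
apply: le_trans (close _ Mr (ww' _ (ltnSn _))) _.
by rewrite exprS invfM -[leRHS]mulrA mulrACA mulVf ?gt_eqF// mul1r [_^-1 * _]mulrC.
Unshelve. all: by end_near.
Qed.
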